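(* Fix $(\bowtie_1,\bowtie_2,\bowtie_3)\in\{(>,\geq,\geq),\ (<,\geq,\leq),\ (>,\leq,\leq),\ (<,\leq,\geq)\}$. Let $\mathcal{R}$ be a constrained TRS over $(\mathcal{F},\mathcal{G}_{\mathbb{Z}},\mathcal{P}_{\mathbb{Z}},\mathcal{M}_{\mathbb{Z}})$ and let $\mathcal{S}\subseteq DP(\mathcal{R})$ be such that the DP problem $(\mathcal{S},\mathcal{R})$ satisfies condition (A3) below. Let $\mathrm{Pol}$ be a linear polynomial interpretation for $\mathcal{D}_\mathcal{R}^\sharp\cup\mathcal{F}$ such that: (i) for every $f/n\in\mathcal{F}$ with $\mathrm{Pol}(f)=b_0+b_1x_1+\cdots+b_nx_n$ we have $b_i\geq 0$ for all $1\le i\le n$; (ii) $\varphi\Rightarrow \mathrm{Pol}(\ell)\bowtie_2 \mathrm{Pol}(r)$ is $\mathcal{M}_{\mathbb{Z}}$-valid for every rule $\ell\to r\ [\varphi]\in\mathcal{R}$; (iii) for every marked symbol $f^\sharp/n$ with $\mathrm{Pol}(f^\sharp)=a_0+a_1x_1+\cdots+a_nx_n$ and every reducible position $i$ of $f^\sharp$ w.r.t. $\mathcal{S}$, $a_i\bowtie_3 0$; (iv) $\varphi\Rightarrow\big(\mathrm{Pol}(s^\sharp)\bowtie_1\mathrm{Pol}(t^\sharp)\ \lor\ \mathrm{Pol}(s^\sharp)\simeq\mathrm{Pol}(t^\sharp)\big)$ is $\mathcal{M}_{\mathbb{Z}}$-valid for every $s^\sharp\to t^\sharp\ [\varphi]\in\mathcal{S}$.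 Define $\mathcal{S}_{\bowtie_1}=\{\,s^\sharp\to t^\sharp\ [\varphi]\in\mathcal{S}\mid \varphi\Rightarrow\mathrm{Pol}(s^\sharp)\bowtie_1\mathrm{Pol}(t^\sharp)\text{ is }\mathcal{M}_{\mathbb{Z}}\text{-valid}\,\}$ and $\mathcal{S}_{\mathsf{bound}}=\{\,s^\sharp\to t^\sharp\ [\varphi]\in\mathcal{S}\mid \varphi\Rightarrow(\mathrm{Pol}(s^\sharp)\bowtie_1 c_0\lor \mathrm{Pol}(s^\sharp)\simeq c_0)\text{ is }\mathcal{M}_{\mathbb{Z}}\text{-valid for some ground }c_0\in T(\mathcal{G}_{\mathbb{Z}})\,\}$, and let the DP processor $\mathit{Proc}^{(\bowtie_1,\bowtie_2,\bowtie_3)}_{\mathsf{PI}}$ map $(\mathcal{S},\mathcal{R})$ to $\{(\mathcal{S}\setminus\mathcal{S}_{\bowtie_1},\mathcal{R}),\ (\mathcal{S}\setminus\mathcal{S}_{\mathsf{bound}},\mathcal{R})\}$. Then each of the four processors $\mathit{Proc}^{(>,\geq,\geq)}_{\mathsf{PI}}$, $\mathit{Proc}^{(<,\geq,\leq)}_{\mathsf{PI}}$, $\mathit{Proc}^{(>,\leq,\leq)}_{\mathsf{PI}}$, $\mathit{Proc}^{(<,\leq,\geq)}_{\mathsf{PI}}$ is sound and complete: $(\mathcal{S},\mathcal{R})$ is finite whenever both output DP problems are finite, and $(\mathcal{S},\mathcal{R})$ is infinite whenever some output DP problem is infinite.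
   Context: Signatures and structure: $\mathcal{F}$ (uninterpreted function symbols) and $\mathcal{G}_{\mathbb{Z}}$ (interpreted function symbols, containing binary $+$ and $-$) are disjoint signatures; $\mathcal{P}_{\mathbb{Z}}$ is a set of predicate symbols containing $>,\geq$ and equality $\simeq$; $\mathcal{M}_{\mathbb{Z}}$ is an LIA-structure: its universe is $\mathbb{Z}$, every $g\in\mathcal{G}_{\mathbb{Z}}$ is interpreted as a linear integer arithmetic expression, every predicate as a Presburger arithmetic relation (with $>,\geq,\simeq$ the usual ones), and every integer is the value of some ground term in $T(\mathcal{G}_{\mathbb{Z}})$. Constraints are quantifier-free formulas over $\mathcal{G}_{\mathbb{Z}},\mathcal{P}_{\mathbb{Z}}$ and variables; $\mathrm{Var}(\varphi)$ denotes the variables of $\varphi$. A formula $\varphi$ is $\mathcal{M}_{\mathbb{Z}}$-valid if $\varphi\sigma$ is true in $\mathcal{M}_{\mathbb{Z}}$ for every ground substitution $\sigma$ with range in $T(\mathcal{G}_{\mathbb{Z}})$ covering $\mathrm{Var}(\varphi)$. Constrained TRS: a finite set $\mathcal{R}$ of rules $\ell\to r\ [\varphi]$ with $\ell,r\in T(\mathcal{F}\cup\mathcal{G}_{\mathbb{Z}},\mathcal{V})$, $\ell$ not a variable, $\varphi$ a constraint, and $\mathrm{Var}(\ell)\supseteq\mathrm{Var}(r)\cup\mathrm{Var}(\varphi)$. Rewriting: $C[\ell\sigma]_p\to_{\mathcal{R}}C[r\sigma]_p$ for a rule $\ell\to r\ [\varphi]$, a context $C$, a substitution $\sigma$ with $\sigma(x)\in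 T(\mathcal{G}_{\mathbb{Z}},\mathcal{V})$ for $x\in\mathrm{Var}(\varphi)$ and $\varphi\sigma$ $\mathcal{M}_{\mathbb{Z}}$-valid; $\to_{\varepsilon,\cdot}$ denotes a step at the root and $\to_{>\varepsilon,\cdot}$ a step strictly below the root. $\mathcal{R}$ is assumed locally sound: for each rule whose left-hand side is rooted by a symbol of $\mathcal{G}_{\mathbb{Z}}$, $r$ and all proper subterms of $\ell$ lie in $T(\mathcal{G}_{\mathbb{Z}},\mathcal{V})$ and $\varphi\Rightarrow \ell\simeq r$ is $\mathcal{M}_{\mathbb{Z}}$-valid. A term is terminating if it admits no infinite $\to_\mathcal{R}$ sequence; $\mathcal{R}$ is terminating if all terms are. Defined symbols $\mathcal{D}_\mathcal{R}$ are the root symbols of left-hand sides. Dependency pairs: for each $f\in\mathcal{D}_\mathcal{R}$ there is a fresh marked symbol $f^\sharp$ (set $\mathcal{D}_\mathcal{R}^\sharp$), and $t^\sharp=f^\sharp(t_1,\dots,t_n)$ for $t=f(t_1,\dots,t_n)$. $DP(\mathcal{R})$ consists of the triples $s^\sharp\to t^\sharp\ [\varphi]$ such that some renamed rule of $\mathcal{R}$ has the form $s\to C[t]\ [\varphi]$ with $\mathit{root}(t)\in\mathcal{D}_\mathcal{R}$. A (minimal) $(\mathcal{S},\mathcal{R})$-chain is a derivation $s_0^\sharp\sigma_0\to_{\varepsilon,\mathcal{S}}t_0^\sharp\sigma_0\to^*_{>\varepsilon,\mathcal{R}}s_1^\sharp\sigma_1\to_{\varepsilon,\mathcal{S}}t_1^\sharp\sigma_1\to^*_{>\varepsilon,\mathcal{R}}\cdots$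 (root steps using pairs of $\mathcal{S}$ as constrained rules) in which every $t_i^\sharp\sigma_i$ is terminating w.r.t. $\mathcal{R}$; it is infinite if it contains infinitely many $\to_{\varepsilon,\mathcal{S}}$ steps. A DP problem $(\mathcal{S},\mathcal{R})$ ($\mathcal{S}\subseteq DP(\mathcal{R})$) is finite if there is no infinite $(\mathcal{S},\mathcal{R})$-chain, and infinite if it is not finite or $\mathcal{R}$ is not terminating. A DP processor (a map from DP problems to finite sets of DP problems) is sound if the input problem is finite whenever all output problems are finite, and complete if the input is infinite whenever some output problem is infinite. Reducible positions: $i$ is a reducible position of $f^\sharp/n$ w.r.t. $\mathcal{S}$ if some pair $s^\sharp\to f^\sharp(t_1,\dots,t_n)\ [\varphi]\in\mathcal{S}$ has $t_i\notin T(\mathcal{G}_{\mathbb{Z}},\mathrm{Var}(\varphi))$. Condition (A3): for every $u\to v\ [\varphi]\in\mathcal{R}\cup\mathcal{S}$ and every subterm $v'$ of $v$ rooted by $-$, the second argument $v'|_2$ lies in $T(\mathcal{G}_{\mathbb{Z}},\mathrm{Var}(\varphi))$. Linear polynomial interpretation for $\mathcal{F}'$: assigns to each $n$-ary $f\in\mathcal{F}'$ a term $\mathrm{Pol}(f)\in T(\mathcal{G}_{\mathbb{Z}},\{x_1,\dots,x_n\})$ representing a linear polynomial $a_0+a_1x_1+\cdots+a_nx_n$ with $a_i\in\mathbb{Z}$. It extends to terms by $\mathrm{Pol}(x)=x$, $\mathrm{Pol}(f(t_1,\dots,t_n))=\mathrm{Pol}(f)\{x_i\mapsto\mathrm{Pol}(t_i)\}$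 if $f\in\mathcal{F}'$, and $\mathrm{Pol}(f(t_1,\dots,t_n))=f(\mathrm{Pol}(t_1),\dots,\mathrm{Pol}(t_n))$ otherwise. Here $\mathcal{F}'=\mathcal{D}_\mathcal{R}^\sharp\cup\mathcal{F}$.
   Formalization: Condition (A3) is extended to every interpreted symbol other than −: its arguments at positions with negative coefficient must also lie in T(G_Z, Var(φ)); without this the claim fails, e.g. for f(x)→f(neg(h)) [x≥0], h→0 with Pol(h)=10. *)

(* Defs.v *)
From Stdlib Require Import List Relation_Operators.
From mathcomp Require Import all_boot all_order all_algebra.
From mathcomp Require Import boolp classical_sets functions cardinality.

Set Implicit Arguments.
Unset Strict Implicit.
Unset Printing Implicit Defensive.

Import Order.TTheory GRing.Theory Num.Theory.
Local Open Scope classical_set_scope.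
Local Open Scope ring_scope.

(** * Terms *)

Record signature := Signature { symb :> Type; arity : symb -> nat }.

(** [sig_sum F G] is the union of two disjoint signatures. *)
Definition sig_sum (F G : signature) : signature :=
  @Signature (F + G)%type
    (fun h => match h with inl f => arity f | inr g => arity g end).

(** [term F X] is T(F, X); in particular [term F void] is the set T(F) of
    ground terms. *)
Inductive term (F : signature) (X : Type) : Type :=
  | Var of X
  | App (f : F) of {ffun 'I_(arity f) -> term F X}.

Arguments Var {F X} x.
Arguments App {F X} f a.

Fixpoint vars (F : signature) (X : Type) (t : term F X) : set X :=
  match t with
  | Var x => [set x]
  | App f a => [set x | exists i, vars (a i) x]
  end.

Fixpoint subst (F : signature) (X Y : Type) (s : X -> term F Y)
    (t : term F X) : term F Y :=
  match t with
  | Var x => s x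
  | App f a => App f [ffun i => subst s (a i)]
  end.

Inductive context (F : signature) (X : Type) : Type :=
  | Hole
  | CApp (f : F) of {ffun 'I_(arity f) -> term F X} & 'I_(arity f)
         & context F X.

(** The [i]-th entry of [a] is irrelevant in [CApp f a i C]. *)
Fixpoint fill (F : signature) (X : Type) (C : context F X) (t : term F X)
    : term F X :=
  match C with
  | Hole => t
  | CApp f a i D => App f [ffun j => if j == i then fill D t else a j]
  end.

Definition subterm (F : signature) (X : Type) (u t : term F X) : Prop :=
  exists C, t = fill C u.

Fixpoint embed (F G : signature) (X : Type) (t : term G X)
    : term (sig_sum F G) X :=
  match t with
  | Var x => Var x
  | App g a => @App (sig_sum F G) X (inr g) [ffun i => embed F (a i)]
  end.

(** [interpreted W t] : t lies in T(G, W). *)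
Definition interpreted (F G : signature) (X : Type) (W : set X)
    (t : term (sig_sum F G) X) : Prop :=
  exists2 u : term G X, vars u `<=` W & t = embed F u.

(** * LIA-structures *)

(** The pair (x, y), when n = 2. *)
Definition args2 (n : nat) (T : Type) (x y : T) : {ffun 'I_n -> T} :=
  [ffun i : 'I_n => if i == 0%N :> nat then x else y].

Definition represents (n : nat) (h : {ffun 'I_n -> int} -> int)
    (a0 : int) (a : 'I_n -> int) : Prop :=
  forall v, h v = a0 + \sum_(i < n) a i * v i.

(** Relations on int definable by a first-order formula of linear integer
    arithmetic; the quantified variable is the one of index 0. *)
Inductive presburger : forall n, ({ffun 'I_n -> int} -> Prop) -> Prop :=
  | PresbLin n (a0 : int) (a : 'I_n -> int) :
      presburger (fun v => 0 <= a0 + \sum_(i < n) a i * v i)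
  | PresbNot n (A : {ffun 'I_n -> int} -> Prop) :
      presburger A -> presburger (fun v => ~ A v)
  | PresbAnd n (A B : {ffun 'I_n -> int} -> Prop) :
      presburger A -> presburger B -> presburger (fun v => A v /\ B v)
  | PresbEx n (A : {ffun 'I_n.+1 -> int} -> Prop) :
      presburger A ->
      presburger (fun v : {ffun 'I_n -> int} =>
        exists z : int, A [ffun i => oapp v z (unlift ord0 i)])
  | PresbExt n (A B : {ffun 'I_n -> int} -> Prop) :
      (forall v, A v <-> B v) -> presburger A -> presburger B.

Fixpoint teval (G : signature)
    (I : forall g : G, {ffun 'I_(arity g) -> int} -> int)
    (X : Type) (v : X -> int) (t : term G X) : int :=
  match t with
  | Var x => v x
  | App g a => I g [ffun i => teval I v (a i)]
  end.

Record LIA := {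
  funs : signature;
  preds : signature;
  lia_plus : funs;
  lia_minus : funs;
  lia_gt : preds;
  lia_ge : preds;
  lia_eq : preds;
  arity_plus : arity lia_plus = 2;
  arity_minus : arity lia_minus = 2;
  arity_gt : arity lia_gt = 2;
  arity_ge : arity lia_ge = 2;
  arity_eq : arity lia_eq = 2;
  fun_interp : forall g : funs, {ffun 'I_(arity g) -> int} -> int;
  pred_interp : forall p : preds, {ffun 'I_(arity p) -> int} -> Prop;
  fun_interp_linear : forall g, exists a0 a, represents (@fun_interp g) a0 a;
  pred_interp_presburger : forall p, presburger (@pred_interp p);
  fun_interp_plus : forall x y, @fun_interp lia_plus (args2 _ x y) = x + y;
  fun_interp_minus : forall x y, @fun_interp lia_minus (args2 _ x y) = x - y;
  pred_interp_gt : forall x y, @pred_interp lia_gt (args2 _ x y) <-> x > y;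
  pred_interp_ge : forall x y, @pred_interp lia_ge (args2 _ x y) <-> x >= y;
  pred_interp_eq : forall x y, @pred_interp lia_eq (args2 _ x y) <-> x = y;
  fun_interp_surj : forall z : int, exists t : term funs void,
    teval fun_interp (of_void int) t = z
}.

(** * Constraints *)

Inductive formula (M : LIA) (X : Type) : Type :=
  | FTrue
  | FAtom (p : preds M) of {ffun 'I_(arity p) -> term (funs M) X}
  | FNot of formula M X
  | FAnd of formula M X & formula M X
  | FOr of formula M X & formula M X
  | FImp of formula M X & formula M X.

Arguments FTrue {M X}.
Arguments FAtom {M X} p a.

Fixpoint fvars (M : LIA) (X : Type) (phi : formula M X) : set X :=
  match phi with
  | FTrue => set0
  | FAtom p a => [set x | exists i, vars (a i) x]
  | FNot phi => fvars phi
  | FAnd phi psi | FOr phi psi | FImp phi psi => fvars phi `|` fvars psi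
  end.

Fixpoint fsubst (M : LIA) (X Y : Type) (s : X -> term (funs M) Y)
    (phi : formula M X) : formula M Y :=
  match phi with
  | FTrue => FTrue
  | FAtom p a => FAtom p [ffun i => subst s (a i)]
  | FNot phi => FNot (fsubst s phi)
  | FAnd phi psi => FAnd (fsubst s phi) (fsubst s psi)
  | FOr phi psi => FOr (fsubst s phi) (fsubst s psi)
  | FImp phi psi => FImp (fsubst s phi) (fsubst s psi)
  end.

(** Truth of a ground formula. *)
Fixpoint holds (M : LIA) (phi : formula M void) : Prop :=
  match phi with
  | FTrue => True
  | FAtom p a =>
      @pred_interp M p [ffun i => teval (@fun_interp M) (of_void int) (a i)]
  | FNot phi => ~ holds phi
  | FAnd phi psi => holds phi /\ holds psi
  | FOr phi psi => holds phi \/ holds psi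
  | FImp phi psi => holds phi -> holds psi
  end.

Definition valid (M : LIA) (X : Type) (phi : formula M X) : Prop :=
  forall s : X -> term (funs M) void, holds (fsubst s phi).

Inductive cmp := CGt | CLt | CGe | CLe.

(** s < t and s <= t stand for t > s and t >= s. *)
Definition fcmp (M : LIA) (X : Type) (c : cmp) (s t : term (funs M) X)
    : formula M X :=
  match c with
  | CGt => FAtom (lia_gt M) (args2 _ s t)
  | CLt => FAtom (lia_gt M) (args2 _ t s)
  | CGe => FAtom (lia_ge M) (args2 _ s t)
  | CLe => FAtom (lia_ge M) (args2 _ t s)
  end.

Definition feq (M : LIA) (X : Type) (s t : term (funs M) X) : formula M X :=
  FAtom (lia_eq M) (args2 _ s t).

Definition icmp (c : cmp) (x y : int) : bool :=
  match c with CGt => x > y | CLt => x < y | CGe => x >= y | CLe => x <= y end.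

(** * Constrained rewriting; the variables are the natural numbers *)

Definition fsig (F : signature) (M : LIA) : signature := sig_sum F (funs M).

Definition fterm (F : signature) (M : LIA) := term (fsig F M) nat.

Definition substitution (F : signature) (M : LIA) := nat -> fterm F M.

Record rule (F : signature) (M : LIA) := Rule {
  lhs : fterm F M;
  rhs : fterm F M;
  cstr : formula M nat
}.

Definition is_ctrs (F : signature) (M : LIA) (R : set (rule F M)) : Prop :=
  finite_set R /\
  forall r, R r ->
    (forall x, lhs r <> Var x) /\
    vars (rhs r) `|` fvars (cstr r) `<=` vars (lhs r).

(** s maps the variables of phi to T(G, V), and phi s is valid. *)
Definition respects (F : signature) (M : LIA) (s : substitution F M)
    (phi : formula M nat) : Prop :=
  exists u : nat -> term (funs M) nat,
    (forall x, fvars phi x -> s x = embed F (u x)) /\ valid (fsubst u phi).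

Definition rewrite (F : signature) (M : LIA) (R : set (rule F M))
    (s t : fterm F M) : Prop :=
  exists (r : rule F M) (C : context (fsig F M) nat) (sigma : substitution F M),
    [/\ R r, respects sigma (cstr r),
        s = fill C (subst sigma (lhs r)) & t = fill C (subst sigma (rhs r))].

Definition terminating_from (T : Type) (step : T -> T -> Prop) (t : T) : Prop :=
  ~ exists u : nat -> T, u 0%N = t /\ forall n, step (u n) (u n.+1).

Definition terminating (F : signature) (M : LIA) (R : set (rule F M)) : Prop :=
  forall t, terminating_from (rewrite R) t.

Definition locally_sound (F : signature) (M : LIA) (R : set (rule F M))
    : Prop :=
  forall (r : rule F M) (g : funs M)
         (a : {ffun 'I_(@arity (fsig F M) (inr g)) -> fterm F M}),
    R r -> lhs r = @App (fsig F M) nat (inr g) a ->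
    (forall C u, lhs r = fill C u -> C <> @Hole _ _ -> interpreted setT u) /\
    exists l' r' : term (funs M) nat,
      [/\ lhs r = embed F l', rhs r = embed F r'
        & valid (FImp (cstr r) (feq l' r'))].

Definition defined (F : signature) (M : LIA) (R : set (rule F M))
    : set (fsig F M) :=
  [set f | exists2 r, R r & exists a, lhs r = App f a].

(** * Dependency pairs *)

(** [Mark f a] is the term whose root is the marked symbol of f; marked
    symbols occur at roots only. *)
Record mterm (F : signature) (M : LIA) := Mark {
  mroot : fsig F M;
  margs : {ffun 'I_(arity mroot) -> fterm F M}
}.

Definition unmark (F : signature) (M : LIA) (t : mterm F M) : fterm F M :=
  App (mroot t) (margs t).

Definition msubst (F : signature) (M : LIA) (s : substitution F M)
    (t : mterm F M) : mterm F M :=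
  @Mark F M (mroot t) [ffun i => subst s (margs t i)].

(** One R-step in an argument; no R-step is possible at a marked root. *)
Definition mrewrite (F : signature) (M : LIA) (R : set (rule F M))
    (s t : mterm F M) : Prop :=
  exists (f : fsig F M) (a b : {ffun 'I_(arity f) -> fterm F M})
         (i : 'I_(arity f)),
    [/\ s = Mark a, t = Mark b, rewrite R (a i) (b i)
      & forall j, j != i -> b j = a j].

Record dpair (F : signature) (M : LIA) := DPair {
  dlhs : mterm F M;
  drhs : mterm F M;
  dcstr : formula M nat
}.

Definition DP (F : signature) (M : LIA) (R : set (rule F M))
    : set (dpair F M) :=
  [set p | exists r delta C,
    [/\ R r, bijective (delta : nat -> nat) &
     [/\ unmark (dlhs p) = subst (fun x => Var (delta x)) (lhs r),
        fill C (unmark (drhs p)) = subst (fun x => Var (delta x)) (rhs r),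
        dcstr p = fsubst (fun x => Var (delta x)) (cstr r)
      & defined R (mroot (drhs p))]]].

Definition dp_problem (F : signature) (M : LIA) : Type :=
  (set (dpair F M) * set (rule F M))%type.

Definition root_step (F : signature) (M : LIA) (p : dpair F M)
    (sigma : substitution F M) (s t : mterm F M) : Prop :=
  [/\ respects sigma (dcstr p), s = msubst sigma (dlhs p)
    & t = msubst sigma (drhs p)].

Definition infinite_chain (F : signature) (M : LIA) (d : dp_problem F M)
    : Prop :=
  exists (p : nat -> dpair F M) (sigma : nat -> substitution F M)
         (s t : nat -> mterm F M),
    forall n,
    [/\ d.1 (p n),
        root_step (p n) (sigma n) (s n) (t n),
        clos_refl_trans _ (mrewrite d.2) (t n) (s n.+1)
      & terminating_from (mrewrite d.2) (t n)].

Definition dp_finite (F : signature) (M : LIA) (d : dp_problem F M) : Prop :=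
  ~ infinite_chain d.

Definition dp_infinite (F : signature) (M : LIA) (d : dp_problem F M) : Prop :=
  ~ dp_finite d \/ ~ terminating d.2.

Definition sound_at (F : signature) (M : LIA)
    (proc : dp_problem F M -> set (dp_problem F M)) (d : dp_problem F M)
    : Prop :=
  (forall d', proc d d' -> dp_finite d') -> dp_finite d.

Definition complete_at (F : signature) (M : LIA)
    (proc : dp_problem F M -> set (dp_problem F M)) (d : dp_problem F M)
    : Prop :=
  (exists2 d', proc d d' & dp_infinite d') -> dp_infinite d.

Definition reducible_position (F : signature) (M : LIA)
    (S : set (dpair F M)) (f : fsig F M) (i : 'I_(arity f)) : Prop :=
  exists (p : dpair F M) (a : {ffun 'I_(arity f) -> fterm F M}),
    [/\ S p, drhs p = Mark a & ~ interpreted (fvars (dcstr p)) (a i)].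

(** [v] is a subterm of the right-hand side of some u -> v' [phi] in R or S.
    For a pair in S, only subterms of the arguments are relevant, since its
    root is marked. *)
Definition rhs_subterm (F : signature) (M : LIA) (d : dp_problem F M)
    (phi : formula M nat) (v : fterm F M) : Prop :=
  (exists2 r, d.2 r & cstr r = phi /\ subterm v (rhs r)) \/
  (exists2 p, d.1 p & dcstr p = phi /\ exists i, subterm v (margs (drhs p) i)).

Definition condA3 (F : signature) (M : LIA) (d : dp_problem F M) : Prop :=
  forall phi (a : {ffun 'I_(@arity (fsig F M) (inr (lia_minus M)))
                   -> fterm F M})
         (i : 'I_(arity (lia_minus M))),
    rhs_subterm d phi (@App (fsig F M) nat (inr (lia_minus M)) a) ->
    i = 1%N :> nat -> interpreted (fvars phi) (a i).

(** The same requirement for the other interpreted symbols, at the arguments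
    with a negative coefficient. It is void if lia_minus is the only interpreted
    symbol with a negative coefficient. It cannot be dropped: let neg be
    interpreted as x |-> - x, let R be f(x) -> f(neg(h)) [x >= 0], h -> 0, let
    S be f#(x) -> f#(neg(h)) [x >= 0], and interpret f#, f and h by x, x and
    10. Then all other hypotheses hold for (>, >=, >=) and both output problems
    have an empty set of pairs, but f#(0), f#(neg(h)), f#(neg(0)), f#(neg(h)),
    and so on, is an infinite chain. *)
Definition condA3_other (F : signature) (M : LIA) (d : dp_problem F M) : Prop :=
  forall phi (g : funs M)
         (a : {ffun 'I_(@arity (fsig F M) (inr g)) -> fterm F M})
         (a0 : int) (c : 'I_(arity g) -> int) (i : 'I_(arity g)),
    rhs_subterm d phi (@App (fsig F M) nat (inr g) a) ->
    g <> lia_minus M -> represents (@fun_interp M g) a0 c -> c i < 0 ->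
    interpreted (fvars phi) (a i).

(** * Linear polynomial interpretations *)

Record linpoly (M : LIA) (n : nat) := LinPoly {
  lterm :> term (funs M) 'I_n;
  lcst : int;
  lcoef : 'I_n -> int;
  lterm_linear :
    represents (fun v : {ffun 'I_n -> int} => teval (@fun_interp M) v lterm)
               lcst lcoef
}.

(** [polm f] interprets the marked symbol of f; it is only used for defined
    symbols f. *)
Record pol_interp (F : signature) (M : LIA) := PolInterp {
  polf : forall f : F, linpoly M (arity f);
  polm : forall f : fsig F M, linpoly M (arity f)
}.

Definition pol_symb (F : signature) (M : LIA) (P : pol_interp F M)
    (X : Type) (h : fsig F M)
    : {ffun 'I_(arity h) -> term (funs M) X} -> term (funs M) X :=
  match h return {ffun 'I_(@arity (fsig F M) h) -> _} -> _ with
  | inl f => fun a => subst a (polf P f)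
  | inr g => fun a => App g a
  end.

Fixpoint pol (F : signature) (M : LIA) (P : pol_interp F M) (X : Type)
    (t : term (fsig F M) X) : term (funs M) X :=
  match t with
  | Var x => Var x
  | App h a => pol_symb P [ffun i => pol P (a i)]
  end.

Definition mpol (F : signature) (M : LIA) (P : pol_interp F M)
    (t : mterm F M) : term (funs M) nat :=
  subst (fun i => pol P (margs t i)) (polm P (mroot t)).

(** * The processors *)

Definition strict_pairs (F : signature) (M : LIA) (P : pol_interp F M)
    (c : cmp) (S : set (dpair F M)) : set (dpair F M) :=
  [set p | S p /\
     valid (FImp (dcstr p) (fcmp c (mpol P (dlhs p)) (mpol P (drhs p))))].

Definition bound_pairs (F : signature) (M : LIA) (P : pol_interp F M)
    (c : cmp) (S : set (dpair F M)) : set (dpair F M) :=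
  [set p | S p /\ exists c0 : term (funs M) void,
     let c0' : term (funs M) nat := subst (of_void _) c0 in
     valid (FImp (dcstr p) (FOr (fcmp c (mpol P (dlhs p)) c0')
                                (feq (mpol P (dlhs p)) c0')))].

Definition proc_PI (F : signature) (M : LIA) (P : pol_interp F M) (c : cmp)
    (d : dp_problem F M) : set (dp_problem F M) :=
  [set (d.1 `\` strict_pairs P c d.1, d.2); (d.1 `\` bound_pairs P c d.1, d.2)].

(* Main.v *)
Require Import Defs.
From Stdlib Require Import List.
From mathcomp Require Import all_boot all_order all_algebra.
From mathcomp Require Import boolp classical_sets functions cardinality.
From mathcomp Require Import ring zify.
From Stdlib Require Import Relation_Operators.

(** Interpret a subterm as infinite when it has, under a negative coefficient,
    an argument outside T(G, V); a term is good when no infinite subterm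
    contributes to its value (0 * infinity = 0). Polynomial evaluation commutes
    with substitution, so validity of (ii) and (iv) always gives the inequality
    for an instance at the root. Validity for all values of the unconstrained
    variables makes their coefficients agree on both sides, so that a root step
    from a good instance ends in a good one; inside a good term the rewriting
    below negative coefficients only affects terms of T(G, V), whose values are
    preserved by local soundness. A pair in S_bound has a left-hand side that
    does not depend on unconstrained variables, hence its right-hand side is
    always instantiated to a good term. After the first step with such a pair
    the values therefore form a monotone sequence of integers, which changes at
    each pair of S_strict and is bounded through the pairs of S_bound. *)

Set Implicit Arguments.
Unset Strict Implicit.
Unset Printing Implicit Defensive.

Import Order.TTheory GRing.Theory Num.Theory.
Local Open Scope classical_set_scope.
Local Open Scope ring_scope.

(** * Terms, substitution and evaluation *)

Section Terms.
Variable F : signature.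

(** Arguments are nested in a finite function, so the recursion at each [a i] is spelled out to give
    one induction hypothesis per argument. *)
Fixpoint term_induction (X : Type) (Q : term F X -> Prop)
    (QVar : forall x, Q (Var x))
    (QApp : forall (f : F) (a : {ffun 'I_(arity f) -> term F X}),
       (forall i, Q (a i)) -> Q (App f a))
    (t : term F X) : Q t :=
  match t with
  | Var x => QVar x
  | App f a => QApp f a (fun i => term_induction QVar QApp (a i))
  end.

Lemma eq_subst (X Y : Type) (s s' : X -> term F Y) (t : term F X) :
  (forall x, vars t x -> s x = s' x) -> subst s t = subst s' t.
Proof.
elim/term_induction: t => [x|f a IH] /= ss'; first exact: ss'.
congr App; apply/ffunP => i; rewrite !ffunE.
by apply: IH => x tx; apply: ss'; exists i.
Qed.

Lemma subst_subst (X Y Z : Type) (s : X -> term F Y) (s' : Y -> term F Z)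
    (t : term F X) :
  subst s' (subst s t) = subst (fun x => subst s' (s x)) t.
Proof.
elim/term_induction: t => [//|f a IH] /=.
by congr App; apply/ffunP => i; rewrite !ffunE IH.
Qed.

Lemma subterm_refl (X : Type) (t : term F X) : subterm t t.
Proof. by exists (@Hole _ _). Qed.

Lemma subterm_arg (X : Type) (f : F) (a : {ffun 'I_(arity f) -> term F X})
    (i : 'I_(arity f)) (u : term F X) :
  subterm u (a i) -> subterm u (App f a).
Proof.
move=> [C aiE]; exists (CApp a i C) => /=.
by congr App; apply/ffunP => j; rewrite ffunE; case: eqP => [->|].
Qed.

(** The type of the arguments depends on the head symbol, so injectivity of [App] takes the form of
    transport of a predicate, obtained by a match on the whole term. *)
Lemma App_eq (X : Type)
    (Q : forall f : F, {ffun 'I_(arity f) -> term F X} -> Prop)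
    (f f' : F) (a : {ffun 'I_(arity f) -> term F X})
    (a' : {ffun 'I_(arity f') -> term F X}) :
  App f a = App f' a' -> Q f' a' -> Q f a.
Proof.
move=> E Qa'; pose Q' t := if t is App f b then Q f b else True.
by rewrite -/(Q' (App f a)) E.
Qed.

Variable I : forall f : F, {ffun 'I_(arity f) -> int} -> int.

Lemma eq_teval (X : Type) (v v' : X -> int) (t : term F X) :
  (forall x, vars t x -> v x = v' x) -> teval I v t = teval I v' t.
Proof.
elim/term_induction: t => [x|f a IH] /= vv'; first exact: vv'.
congr I; apply/ffunP => i; rewrite !ffunE.
by apply: IH => x tx; apply: vv'; exists i.
Qed.

Lemma teval_subst (X Y : Type) (s : X -> term F Y) (v : Y -> int)
    (t : term F X) :
  teval I v (subst s t) = teval I (fun x => teval I v (s x)) t.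
Proof.
elim/term_induction: t => [//|f a IH] /=.
by congr I; apply/ffunP => i; rewrite !ffunE IH.
Qed.

End Terms.

Lemma args2_map (n : nat) (T U : Type) (h : T -> U) (x y : T) :
  [ffun i => h (args2 n x y i)] = args2 n (h x) (h y).
Proof. by apply/ffunP => i; rewrite !ffunE; case: ifP. Qed.

(** * Truth of constraints under integer valuations *)

Section Formulas.
Variable M : LIA.
Notation I := (@fun_interp M).

Fixpoint fsem (X : Type) (v : X -> int) (phi : formula M X) : Prop :=
  match phi with
  | FTrue => True
  | FAtom p a => @pred_interp M p [ffun i => teval I v (a i)]
  | FNot phi => ~ fsem v phi
  | FAnd phi psi => fsem v phi /\ fsem v psi
  | FOr phi psi => fsem v phi \/ fsem v psi
  | FImp phi psi => fsem v phi -> fsem v psi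
  end.

Lemma holds_fsem (phi : formula M void) : holds phi = fsem (of_void int) phi.
Proof. by elim: phi => //= [phi ->|phi -> psi ->|phi -> psi ->|phi -> psi ->]. Qed.

Lemma fsem_fsubst (X Y : Type) (s : X -> term (funs M) Y) (v : Y -> int)
    (phi : formula M X) :
  fsem v (fsubst s phi) = fsem (fun x => teval I v (s x)) phi.
Proof.
elim: phi => //= [p a|phi ->|phi -> psi ->|phi -> psi ->|phi -> psi ->] //.
by congr (pred_interp _); apply/ffunP => i; rewrite !ffunE teval_subst.
Qed.

Lemma eq_fsem (X : Type) (v v' : X -> int) (phi : formula M X) :
  (forall x, fvars phi x -> v x = v' x) -> fsem v phi = fsem v' phi.
Proof.
elim: phi => //= [p a|phi IH|phi IH psi IH'|phi IH psi IH'|phi IH psi IH'] vv'.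
- congr (pred_interp _); apply/ffunP => i; rewrite !ffunE.
  by apply: eq_teval => x ax; apply: vv'; exists i.
- by rewrite IH.
- by rewrite IH ?IH' // => x ?; apply: vv'; [right|left].
- by rewrite IH ?IH' // => x ?; apply: vv'; [right|left].
- by rewrite IH ?IH' // => x ?; apply: vv'; [right|left].
Qed.

(** Every integer is the value of a ground term, so each valuation is realised by a ground
    substitution. *)
Lemma valid_fsem (X : Type) (v : X -> int) (phi : formula M X) :
  valid phi -> fsem v phi.
Proof.
move=> vphi; pose s x := projT1 (cid (fun_interp_surj M (v x))).
have := vphi s; rewrite holds_fsem fsem_fsubst; congr fsem.
by apply/funext => x; rewrite /s; case: cid.
Qed.

Lemma fsem_fcmp (X : Type) (c : cmp) (v : X -> int) (s t : term (funs M) X) :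
  fsem v (fcmp c s t) <-> icmp c (teval I v s) (teval I v t).
Proof.
by case: c; rewrite /= args2_map; [exact: pred_interp_gt|exact: pred_interp_gt
  |exact: pred_interp_ge|exact: pred_interp_ge].
Qed.

Lemma fsem_feq (X : Type) (v : X -> int) (s t : term (funs M) X) :
  fsem v (feq s t) <-> teval I v s = teval I v t.
Proof. by rewrite /= args2_map; exact: pred_interp_eq. Qed.

End Formulas.

(** * Terms over the interpreted signature *)

Section Embedding.
Variables F G : signature.

Lemma vars_embed (X : Type) (u : term G X) : vars (embed F u) = vars u.
Proof.
elim/term_induction: u => [//|g a IH] /=; apply/seteqP.
by split=> x [i]; rewrite ?ffunE ?IH => ?; exists i; rewrite ?ffunE ?IH.
Qed.

Lemma interpreted_embed (X : Type) (u : term G X) :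
  interpreted setT (embed F u).
Proof. by exists u. Qed.

Lemma interpreted_App (X : Type) (f : sig_sum F G)
    (a : {ffun 'I_(arity f) -> term (sig_sum F G) X}) :
  interpreted setT (App f a) ->
  (exists g, f = inr g) /\ forall i, interpreted setT (a i).
Proof.
case=> [[//|g b]] _ /= E.
pose Q (h : sig_sum F G) (c : {ffun 'I_(arity h) -> term (sig_sum F G) X}) :=
  (exists g, h = inr g) /\ forall i, interpreted setT (c i).
apply: (@App_eq _ _ Q _ _ _ _ E); rewrite /Q.
by split=> [|i]; [exists g|rewrite ffunE; exact: interpreted_embed].
Qed.

Lemma App_interpreted (X : Type) (g : G)
    (a : {ffun 'I_(@arity (sig_sum F G) (inr g)) -> term (sig_sum F G) X}) :
  (forall i, interpreted setT (a i)) ->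
  interpreted setT (@App (sig_sum F G) X (inr g) a).
Proof.
move=> aG; have /choice [u uE] : forall i, exists u, a i = embed F u.
  by move=> i; have [u _ ->] := aG i; exists u.
exists (App g (finfun u)) => //=; congr App.
by apply/ffunP => i; rewrite !ffunE.
Qed.

Lemma interpreted_subst_var (X Y : Type) (s : X -> term (sig_sum F G) Y)
    (t : term (sig_sum F G) X) :
  interpreted setT (subst s t) ->
  forall x, vars t x -> interpreted setT (s x).
Proof.
elim/term_induction: t => [x|f a IH] /= stG y; first by move->.
move=> [i aiy]; apply: IH aiy.
by have [_ /(_ i)] := interpreted_App stG; rewrite ffunE.
Qed.

Lemma interpreted_subst (X Y : Type) (s : X -> term (sig_sum F G) Y)
    (W : set X) (t : term (sig_sum F G) X) :
  interpreted W t -> (forall x, W x -> interpreted setT (s x)) ->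
  interpreted setT (subst s t).
Proof.
case=> u + ->; elim/term_induction: u => [x|g a IH] /= uW sG.
  by apply/sG/uW.
apply: App_interpreted => i; rewrite !ffunE.
by apply: IH => // x aix; apply: uW; exists i.
Qed.

End Embedding.

(** * Polynomial values, good terms and slopes *)

Section Values.
Variables (F : signature) (M : LIA) (P : pol_interp F M).
Notation I := (@fun_interp M).
Notation isG := (@interpreted F (funs M) nat setT).

Lemma fun_interp_pol (g : funs M) :
  exists p : int * ('I_(arity g) -> int), represents (@I g) p.1 p.2.
Proof. by have [a0 [a ?]] := fun_interp_linear g; exists (a0, a). Qed.

Definition gpol (g : funs M) := projT1 (cid (fun_interp_pol g)).

Lemma gpolP (g : funs M) : represents (@I g) (gpol g).1 (gpol g).2.
Proof. by rewrite /gpol; case: cid. Qed.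

Definition pcst (h : fsig F M) : int :=
  match h with inl f => lcst (polf P f) | inr g => (gpol g).1 end.

Definition pcoef (h : fsig F M) : 'I_(arity h) -> int :=
  match h return 'I_(@arity (fsig F M) h) -> int with
  | inl f => lcoef (polf P f)
  | inr g => (gpol g).2
  end.

Definition pval (v : nat -> int) (t : fterm F M) : int := teval I v (pol P t).

Lemma pval_App (v : nat -> int) (h : fsig F M)
    (a : {ffun 'I_(arity h) -> fterm F M}) :
  pval v (App h a) = pcst h + \sum_i pcoef i * pval v (a i).
Proof.
rewrite /pval; case: h a => [f|g] a /=.
  rewrite teval_subst.
  transitivity (teval I [ffun i => pval v (a i)] (polf P f)).
    by apply: eq_teval => i _; rewrite !ffunE.
  rewrite (lterm_linear (polf P f)); congr (_ + _).
  by apply: eq_bigr => i _; rewrite ffunE.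
rewrite gpolP; congr (_ + _); apply: eq_bigr => i _.
by rewrite !ffunE.
Qed.

Lemma pval_subst (s : substitution F M) (v : nat -> int) (t : fterm F M) :
  pval v (subst s t) = pval (fun x => pval v (s x)) t.
Proof.
elim/term_induction: t => [//|h a IH] /=.
rewrite !pval_App; congr (_ + _).
by apply: eq_bigr => i _; rewrite ffunE IH.
Qed.

Lemma pval_embed (v : nat -> int) (u : term (funs M) nat) :
  pval v (embed F u) = teval I v u.
Proof.
elim/term_induction: u => [//|g a IH].
rewrite /pval /=; congr (@fun_interp M g _).
by apply/ffunP => i; rewrite !ffunE -IH.
Qed.

Lemma pval_interpreted (W : set nat) (v v' : nat -> int) (t : fterm F M) :
  interpreted W t -> (forall x, W x -> v x = v' x) -> pval v t = pval v' t.
Proof.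
case=> u uW -> vv'; rewrite !pval_embed.
by apply: eq_teval => x ux; apply/vv'/uW.
Qed.

Definition mval (v : nat -> int) (t : mterm F M) : int := teval I v (mpol P t).

Lemma mvalE (v : nat -> int) (t : mterm F M) :
  mval v t = lcst (polm P (mroot t))
    + \sum_i lcoef (polm P (mroot t)) i * pval v (margs t i).
Proof.
rewrite /mval /mpol teval_subst.
transitivity (teval I [ffun i => pval v (margs t i)] (polm P (mroot t))).
  by apply: eq_teval => i _; rewrite !ffunE.
rewrite (lterm_linear (polm P (mroot t))); congr (_ + _).
by apply: eq_bigr => i _; rewrite ffunE.
Qed.

Lemma mval_msubst (s : substitution F M) (v : nat -> int) (t : mterm F M) :
  mval v (msubst s t) = mval (fun x => pval v (s x)) t.
Proof.
rewrite !mvalE /=; congr (_ + _); apply: eq_bigr => i _.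
by rewrite ffunE pval_subst.
Qed.

(* For eta = -1 the roles of positive and negative coefficients are exchanged;
   this occurs below marked symbols. *)
Definition good_args (n : nat) (eta : int) (c : 'I_n -> int)
    (Gb fb : 'I_n -> Prop) : Prop :=
  forall i, (eta * c i < 0 -> Gb i) /\ (c i <> 0 -> fb i).

Fixpoint good (t : fterm F M) : Prop :=
  match t with
  | Var x => True
  | App h a => good_args 1 (@pcoef h) (fun i => isG (a i)) (fun i => good (a i))
  end.

Lemma interpreted_good (t : fterm F M) : isG t -> good t.
Proof.
elim/term_induction: t => [//|h a IH] /= /interpreted_App [_ aG] i.
by split=> _; [|apply: IH].
Qed.

Definition term_value (t : fterm F M) : int := pval (fun=> 0) t.

(** Variables with a bad instance receive the free parameter [N]; dependence on [N] then reveals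
    infinite contributions. *)
Definition shift (s : substitution F M) (N : int) (x : nat) : int :=
  if `[< good (s x) >] then term_value (s x) else N.

Lemma shift_good (s : substitution F M) (N : int) (x : nat) :
  good (s x) -> shift s N x = term_value (s x).
Proof. by rewrite /shift => gx; case: asboolP. Qed.

(** Constraint variables are instantiated in T(G, V), so only the values there matter; this covers
    the actual values as well as every [shift]. *)
Lemma respectsP (s : substitution F M) (phi : formula M nat) :
  respects s phi ->
  (forall x, fvars phi x -> isG (s x)) /\
  forall v, (forall x, isG (s x) -> v x = term_value (s x)) -> fsem v phi.
Proof.
case=> u [su uphi]; split=> [x phix|v vs].
  by rewrite su //; exact: interpreted_embed.
have := valid_fsem (fun=> 0) uphi; rewrite fsem_fsubst.
rewrite (@eq_fsem _ _ _ v) // => x phix; rewrite vs su //.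
  by rewrite /term_value pval_embed.
exact: interpreted_embed.
Qed.

Lemma respects_value (s : substitution F M) (phi : formula M nat) :
  respects s phi -> fsem (fun x => term_value (s x)) phi.
Proof. by move=> /respectsP [_]; apply. Qed.

Lemma respects_shift (s : substitution F M) (N : int) (phi : formula M nat) :
  respects s phi -> fsem (shift s N) phi.
Proof.
by move=> /respectsP [_]; apply => x ?; apply/shift_good/interpreted_good.
Qed.

(** In a good instance a bad argument can only occur under coefficient 0, where it contributes
    nothing. *)
Lemma pval_shift_const (s : substitution F M) (N N' : int) (t : fterm F M) :
  good (subst s t) -> pval (shift s N) t = pval (shift s N') t.
Proof.
elim/term_induction: t => [x /= gx|h a IH /= ga].
  by rewrite /pval /= !shift_good.
rewrite !pval_App; congr (_ + _); apply: eq_bigr => i _.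
have [->|/eqP ci] := eqVneq (pcoef i) 0; first by rewrite !mul0r.
by congr (_ * _); apply: IH; have [_ /(_ ci)] := ga i; rewrite ffunE.
Qed.

Lemma pval_shift_linear (s : substitution F M) (t : fterm F M) :
  exists m, forall N, pval (shift s N) t = pval (shift s 0) t + m * N.
Proof.
elim/term_induction: t => [x|h a /choice [m IH]].
  exists (if `[< good (s x) >] then 0 else 1) => N.
  by rewrite /pval /= /shift; case: ifP => _; lia.
exists (\sum_i pcoef i * m i) => N; rewrite !pval_App -addrA; congr (_ + _).
rewrite mulr_suml -big_split /=; apply: eq_bigr => i _.
by rewrite IH; ring.
Qed.

Lemma mval_shift_linear (s : substitution F M) (t : mterm F M) :
  exists m, forall N, mval (shift s N) t = mval (shift s 0) t + m * N.
Proof.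
have /choice [m mE] := fun i => pval_shift_linear s (margs t i).
exists (\sum_i lcoef (polm P (mroot t)) i * m i) => N.
rewrite !mvalE -addrA; congr (_ + _).
rewrite mulr_suml -big_split /=; apply: eq_bigr => i _.
by rewrite mE; ring.
Qed.

Definition slope (s : substitution F M) (t : fterm F M) (m : int) : Prop :=
  [/\ 0 <= m, ~ good (subst s t) -> 0 < m &
      forall N, pval (shift s N) t = pval (shift s 0) t + m * N].

(** Arguments with [eta * c i < 0] only use variables of [W], whose instances are good, so they are
    constant in [N]. All other summands have slopes that are nonnegative after multiplication by
    [eta], and a bad argument that counts makes one of them positive. *)
Lemma slope_args (n : nat) (eta : int) (c : 'I_n -> int)
    (b : 'I_n -> fterm F M) (s : substitution F M) (W : set nat) :
  (forall x, W x -> isG (s x)) ->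
  (forall i, eta * c i < 0 -> interpreted W (b i)) ->
  (forall i, exists m, slope s (b i) m) -> eta != 0 ->
  exists m, [/\ 0 <= eta * m,
    ~ good_args eta c (fun i => isG (subst s (b i)))
        (fun i => good (subst s (b i))) -> 0 < eta * m &
    forall N, \sum_i c i * pval (shift s N) (b i)
      = \sum_i c i * pval (shift s 0) (b i) + m * N].
Proof.
move=> WG bW /choice [m mP] eta0.
have bG i : eta * c i < 0 -> isG (subst s (b i)).
  by move=> /bW bi; apply: interpreted_subst bi WG.
pose k i := c i * (if eta * c i < 0 then 0 else m i).
have k_ge0 i : 0 <= eta * k i.
  have [m_ge0 _ _] := mP i; rewrite /k mulrA.
  by case: ltP => ci; [rewrite mulr0|apply: mulr_ge0].
exists (\sum_i k i); rewrite mulr_sumr; split.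
- by apply: sumr_ge0 => i _.
- move=> /existsNP [i]; rewrite not_andE !not_implyE => -[[/bG //]|[ci ngi]].
  have [_ /(_ ngi) m_gt0 _] := mP i.
  rewrite (bigD1 i) //= ltr_wpDr ?sumr_ge0 // /k mulrA.
  have [/bG/interpreted_good//|eci] := ltP (eta * c i) 0; rewrite mulr_gt0 //.
  by rewrite lt_def eci mulf_neq0 //; apply/eqP.
- move=> N; rewrite mulr_suml -big_split /=; apply: eq_bigr => i _.
  rewrite /k; case: ltP => [/bW biW|_].
    rewrite mulr0 mul0r addr0; congr (_ * _).
    apply: pval_interpreted biW _ => x /WG/interpreted_good gx.
    by rewrite !shift_good.
  by have [_ _ ->] := mP i; ring.
Qed.

Definition neg_args_interpreted (W : set nat) (t : fterm F M) : Prop :=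
  forall (h : fsig F M) (a : {ffun 'I_(arity h) -> fterm F M})
    (i : 'I_(arity h)),
    subterm (App h a) t -> pcoef i < 0 -> interpreted W (a i).

Lemma slope_ex (s : substitution F M) (W : set nat) (t : fterm F M) :
  (forall x, W x -> isG (s x)) -> neg_args_interpreted W t ->
  exists m, slope s t m.
Proof.
move=> WG; elim/term_induction: t => [x _|h a IH negt].
  exists (if `[< good (s x) >] then 0 else 1); rewrite /slope /pval /shift /=.
  by case: asboolP => gx; split=> // N; lia.
have [|||m [m_ge0 m_gt0 mE]] :=
    @slope_args _ 1 (@pcoef h) (fun i => a i) s W WG.
- by move=> i; rewrite mul1r; apply: negt (subterm_refl _).
- by move=> i; apply: IH => h' a' j sub; apply: negt (subterm_arg sub).
- by [].
rewrite !mul1r in m_ge0 m_gt0; exists m; split=> // [nga|N].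
  apply: m_gt0; apply: contra_not nga => ga i /=; rewrite ffunE; exact: ga.
by rewrite !pval_App mE addrA.
Qed.

Lemma bounded_linear (eta b m k : int) :
  eta != 0 -> (forall N, eta * (b + m * N) <= k) -> m = 0.
Proof.
move=> eta0 bd; apply/eqP/contraT => m0.
(* For this [N], [eta * m * N] is [(eta * m) ^+ 2] times a number exceeding [k - eta * b]. *)
have := bd (eta * m * (`|k| + `|eta * b| + 1)).
have : 1 <= (eta * m) ^+ 2 by rewrite -gtz0_ge1 exprn_even_gt0 //= mulf_neq0.
move: (ler_norm k) (ler_norm (- (eta * b))); rewrite normrN => ? ?.
move: (normr_ge0 k) (normr_ge0 (eta * b)) => ? ?.
nia.
Qed.

End Values.

(** * Preservation of goodness and monotonicity of values under rewriting *)

Section Rewriting.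
Variables (F : signature) (M : LIA) (P : pol_interp F M).
Notation isG := (@interpreted F (funs M) nat setT).
Notation good := (good P).
Notation value := (term_value P).

(** Comparing the values of subtraction at (1, 0) and (0, 0) shows that its coefficient at index 0
    is 1. *)
Lemma minus_coef (i : 'I_(arity (lia_minus M))) :
  (gpol (lia_minus M)).2 i < 0 -> i = 1%N :> nat.
Proof.
move=> ci_lt0; apply: contrapT => i1.
have i0 : i = 0%N :> nat by move: (ltn_ord i) (arity_minus M); lia.
have := fun_interp_minus M 1 0; have := fun_interp_minus M 0 0.
rewrite !gpolP (bigD1 i) // [in X in _ -> X -> _](bigD1 i) //=.
rewrite !big1 ?ffunE ?i0 /=; first lia.
all: move=> j ji; rewrite ffunE ?if_same ?mulr0 //.
by case: eqP => [j0|]; [case/eqP: ji; apply: val_inj; rewrite /= j0 i0|rewrite mulr0].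
Qed.

(** Uninterpreted symbols have no negative coefficients, (A3) handles [lia_minus], and
    [condA3_other] the remaining interpreted symbols. *)
Lemma condA3_neg_args (d : dp_problem F M) (phi : formula M nat)
    (t : fterm F M) :
  (forall (f : F) (i : 'I_(arity f)), lcoef (polf P f) i >= 0) ->
  condA3 d -> condA3_other d ->
  (forall u, subterm u t -> rhs_subterm d phi u) ->
  neg_args_interpreted P (fvars phi) t.
Proof.
move=> polf_ge0 A3 A3o td [f|g] a i /td sub /= ci.
  by move: ci; rewrite ltNge polf_ge0.
have [E|gE] := pselect (g = lia_minus M); last first.
  exact: A3o sub gE (@gpolP _ g) ci.
by subst g; apply: (A3 _ _ _ sub); apply: minus_coef.
Qed.

(** A redex inside T(G, V) has an interpreted root, so by local soundness contracting it preserves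
    the value. *)
Lemma rewrite_interpreted (R : set (rule F M)) (s t : fterm F M) :
  is_ctrs R -> locally_sound R -> rewrite R s t -> isG s ->
  isG t /\ value t = value s.
Proof.
move=> [_ ctrsR] sndR [r [C [sigma [Rr resp -> ->]]]].
elim: C => [|h a i C IH] /=.
  have [lhsV varsR] := ctrsR r Rr.
  case lhsE : (lhs r) => [x|h a]; first by have := lhsV x.
  rewrite -lhsE; case: h a lhsE => [f|g] a lhsE lG.
    by move: lG; rewrite lhsE /= => /interpreted_App[[]].
  have [_ [l' [r' [l'E r'E vlr]]]] := sndR r g a Rr lhsE.
  split.
    apply: (@interpreted_subst _ _ _ _ _ (vars r')).
      by rewrite r'E; exists r'.
    move=> x r'x; apply: interpreted_subst_var lG _ _.
    by apply: varsR; left; rewrite r'E vars_embed.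
  rewrite /term_value !pval_subst l'E r'E !pval_embed; apply/esym.
  have := valid_fsem (fun x => value (sigma x)) vlr.
  by move=> /= /(_ (respects_value P resp)) /fsem_feq.
case: h a i => [f|g] a i; move=> sG; have [[g' //]] := interpreted_App sG.
move=> _ aG; have [|tG tE] := IH; first by have := aG i; rewrite ffunE eqxx.
split.
  apply: App_interpreted => j; rewrite ffunE; case: eqP => // /eqP/negPf ji.
  by have := aG j; rewrite ffunE ji.
rewrite /term_value !pval_App; congr (_ + _); apply: eq_bigr => j _.
by rewrite !ffunE; case: eqP => // _; congr (_ * _).
Qed.

(** If [eta * c i] is negative, the rewritten argument lies in T(G, V) and keeps its value; if it is
    positive, the weak decrease is scaled by a positive factor. *)
Lemma good_args_step (n : nat) (eta eps : int) (c : 'I_n -> int)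
    (a b : 'I_n -> fterm F M) (i : 'I_n) :
  (isG (a i) -> isG (b i) /\ value (b i) = value (a i)) ->
  (good (a i) -> good (b i) /\ eps * value (b i) <= eps * value (a i)) ->
  (forall j, j != i -> b j = a j) ->
  good_args eta c (fun i => isG (a i)) (fun i => good (a i)) ->
  good_args eta c (fun i => isG (b i)) (fun i => good (b i)) /\
  eta * eps * \sum_j c j * value (b j) <= eta * eps * \sum_j c j * value (a j).
Proof.
move=> stepG stepg ab ga; split=> [j|].
  have [->|ji] := eqVneq j i; last by rewrite ab.
  have [aG ag] := ga i; split=> [/aG/stepG[]//|/ag/stepg[]//].
rewrite !mulr_sumr; apply: ler_sum => j _.
have [->|ji] := eqVneq j i; last by rewrite ab.
have [aG ag] := ga i.
have [/aG/stepG [_ ->]//|ci_ge0] := ltP (eta * c i) 0.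
have [->|/eqP/ag/stepg [_ le_ba]] := eqVneq (c i) 0; first by rewrite !mul0r.
by rewrite -!mulrA ![eps * (c i * _)]mulrCA !mulrA -!(mulrA (eta * c i))
  ler_wpM2l.
Qed.

Section System.
Variables (R : set (rule F M)) (eps : int).
Hypotheses (ctrsR : is_ctrs R) (sndR : locally_sound R) (eps0 : eps != 0).
Hypothesis rhs_neg :
  forall r, R r -> neg_args_interpreted P (fvars (cstr r)) (rhs r).
Hypothesis rule_le : forall r v, R r -> fsem v (cstr r) ->
  eps * pval P v (rhs r) <= eps * pval P v (lhs r).

(* Giving the value N to every variable instantiated by a bad term leaves the
   left-hand side unchanged when its instance is good, while the right-hand
   side, whose negative arguments contain no such variable, is unbounded
   unless its instance is good. *)
Lemma rewrite_good (s t : fterm F M) :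
  rewrite R s t -> good s -> good t /\ eps * value t <= eps * value s.
Proof.
move=> [r [C [sigma [Rr resp -> ->]]]].
elim: C => [|h a i C IH] /=.
  move=> lg; split; last first.
    by rewrite /term_value !pval_subst; apply/rule_le/respects_value.
  apply: contrapT => nrg.
  have [sG _] := respectsP P resp.
  have [m [_ /(_ nrg) m_gt0 mE]] := slope_ex sG (rhs_neg Rr).
  suff m0 : m = 0 by rewrite m0 ltxx in m_gt0.
  apply: (@bounded_linear eps (pval P (shift P sigma 0) (rhs r)) m
    (eps * pval P (shift P sigma 0) (lhs r))) => // N.
  rewrite -mE (pval_shift_const 0 N lg); apply: rule_le => //.
  exact: respects_shift.
move=> ga.
pose s' := fill C (subst sigma (lhs r)); pose t' := fill C (subst sigma (rhs r)).
have st : rewrite R s' t' by exists r, C, sigma.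
have [] := @good_args_step _ 1 eps (@pcoef _ _ P h)
  (fun j => [ffun j => if j == i then s' else a j] j)
  (fun j => [ffun j => if j == i then t' else a j] j) i.
- by rewrite !ffunE eqxx; apply: rewrite_interpreted st.
- by rewrite !ffunE eqxx.
- by move=> j /negPf ji; rewrite !ffunE ji.
- exact: ga.
- move=> gb le_ba; split; first exact: gb.
  by rewrite /term_value !pval_App !mulrDr lerD2l; move: le_ba; rewrite mul1r.
Qed.

Definition mgood (eta : int) (t : mterm F M) : Prop :=
  good_args eta (lcoef (polm P (mroot t))) (fun i => isG (margs t i))
    (fun i => good (margs t i)).

Lemma mrewrite_good (eta : int) (s t : mterm F M) :
  mrewrite R s t -> mgood eta s ->
  mgood eta t /\
  eta * eps * mval P (fun=> 0) t <= eta * eps * mval P (fun=> 0) s.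
Proof.
move=> [f [a [b [i [-> -> st ab]]]]] ga.
have [||||gb le_ba] :=
  @good_args_step _ eta eps (lcoef (polm P f)) (fun j => a j) (fun j => b j) i.
- exact: rewrite_interpreted st.
- exact: rewrite_good st.
- exact: ab.
- exact: ga.
by split; [exact: gb|rewrite !mvalE !mulrDr lerD2l].
Qed.

Lemma mrewrites_good (eta : int) (s t : mterm F M) :
  clos_refl_trans _ (mrewrite R) s t -> mgood eta s ->
  mgood eta t /\
  eta * eps * mval P (fun=> 0) t <= eta * eps * mval P (fun=> 0) s.
Proof.
elim=> [s' t'|s'|s' t' u _ IH _ IH'] //; first exact: mrewrite_good.
move=> /IH [gt le_ts]; have [gu le_ut] := IH' gt.
by split=> //; apply: le_trans le_ut le_ts.
Qed.

End System.

(** A bad instance would have a nonzero slope in [N], which is impossible under a bound for all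
    integers [N]. *)
Lemma bounded_msubst_good (eta delta k : int) (t : mterm F M)
    (sigma : substitution F M) (W : set nat) :
  eta != 0 -> delta != 0 ->
  (forall x, W x -> isG (sigma x)) ->
  (forall i, neg_args_interpreted P W (margs t i)) ->
  (forall i, eta * lcoef (polm P (mroot t)) i < 0 ->
     interpreted W (margs t i)) ->
  (forall N, delta * mval P (shift P sigma N) t <= k) ->
  mgood eta (msubst sigma t).
Proof.
move=> eta0 delta0 WG tneg tred bd; apply: contrapT => ngt.
have [|i|//|m [_ m_gt0 mE]] := @slope_args _ _ P _ eta
  (lcoef (polm P (mroot t))) (fun i => margs t i) sigma W WG.
- exact: tred.
- exact: slope_ex WG (tneg i).
have : 0 < eta * m.
  by apply: m_gt0; apply: contra_not ngt => gt i /=; rewrite ffunE; apply: gt.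
suff -> : m = 0 by rewrite mulr0 ltxx.
apply: (@bounded_linear delta (mval P (shift P sigma 0) t) m k) => // N.
by have := bd N; rewrite !mvalE mE addrA.
Qed.

Lemma mval_shift_const (eta : int) (sigma : substitution F M) (N N' : int)
    (t : mterm F M) :
  mgood eta (msubst sigma t) ->
  mval P (shift P sigma N) t = mval P (shift P sigma N') t.
Proof.
move=> gt; rewrite !mvalE; congr (_ + _); apply: eq_bigr => i _.
have [->|/eqP ci] := eqVneq (lcoef (polm P (mroot t)) i) 0.
  by rewrite !mul0r.
congr (_ * _); apply: pval_shift_const.
by have [_ /(_ ci)] := gt i; rewrite /= ffunE.
Qed.

End Rewriting.

(** * Renamed pairs, uniform bounds and recurrence in chains *)

Section Pairs.
Variables (F : signature) (M : LIA) (P : pol_interp F M).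

Lemma unmark_inj : injective (@unmark F M).
Proof.
move=> [f a] [g b] /= E; pose Q h (c : {ffun 'I_(arity h) -> fterm F M}) :=
  Mark c = Mark b.
exact: (@App_eq _ _ Q _ _ _ _ E).
Qed.

Lemma unmark_msubst (s : substitution F M) (t : mterm F M) :
  unmark (msubst s t) = subst s (unmark t).
Proof. by []. Qed.

Lemma fsubst_fsubst (X Y Z : Type) (s : X -> term (funs M) Y)
    (s' : Y -> term (funs M) Z) (phi : formula M X) :
  fsubst s' (fsubst s phi) = fsubst (fun x => subst s' (s x)) phi.
Proof.
elim: phi => //= [p a|phi ->|phi -> psi ->|phi -> psi ->|phi -> psi ->] //.
by congr FAtom; apply/ffunP => i; rewrite !ffunE subst_subst.
Qed.

(** Only the left-hand side and the constraint are compared, since the lower bound concerns nothing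
    else. *)
Definition pair_of_rule (r : rule F M) (p : dpair F M) : Prop :=
  exists delta : nat -> nat, [/\ bijective delta,
    unmark (dlhs p) = subst (fun x => Var (delta x)) (lhs r) &
    dcstr p = fsubst (fun x => Var (delta x)) (cstr r)].

Lemma DP_pair_of_rule (R : set (rule F M)) (p : dpair F M) :
  DP R p -> exists2 r, R r & pair_of_rule r p.
Proof. by move=> [r [delta [C [Rr bd [lE _ cE _]]]]]; exists r => //; exists delta. Qed.

(** The first renaming is undone by its inverse before the second is applied. *)
Lemma pair_of_rule_renaming (r : rule F M) (p p' : dpair F M) :
  pair_of_rule r p -> pair_of_rule r p' ->
  exists rho : nat -> nat,
    dlhs p' = msubst (fun x => Var (rho x)) (dlhs p) /\
    dcstr p' = fsubst (fun x => Var (rho x)) (dcstr p).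
Proof.
move=> [delta [[delta' dK _] lE cE]] [eta [_ lE' cE']].
exists (fun x => eta (delta' x)); split.
  apply: unmark_inj; rewrite unmark_msubst lE lE' subst_subst /=.
  by apply: eq_subst => x _; rewrite dK.
rewrite cE cE' fsubst_fsubst /=; congr fsubst.
by apply/funext => x; rewrite dK.
Qed.

Lemma finite_uniform_bound (T : Type) (A : set T) (Q : T -> int -> Prop) :
  finite_set A -> (forall a k k', k' <= k -> Q a k -> Q a k') ->
  (forall a, A a -> exists k, Q a k) -> exists k, forall a, A a -> Q a k.
Proof.
move=> finA Qmon QA.
(* [{classic T}] provides decidable equality, so that the finite set becomes a sequence. *)
have [s sE] := (@finite_seqP {classic T} A).1 finA.
have : forall a, a \in s -> exists k, Q a k.
  by move=> a sa; apply: QA; rewrite sE.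
rewrite sE; elim: s {sE} => [|b s IH] Qs; first by exists 0.
have [|k Qk] := IH; first by move=> a sa; apply: Qs; rewrite inE sa orbT.
have [k' Qk'] := Qs b (mem_head _ _).
exists (Num.min k k') => a /=; rewrite inE => /orP[/eqP->|sa].
  by apply: Qmon Qk'; rewrite ge_min lexx orbT.
by apply: Qmon (Qk _ sa); rewrite ge_min lexx.
Qed.

(* The lower bound of a pair depends only on the rule it comes from, so that
   finiteness of R yields a common bound although S may contain infinitely
   many renamed pairs. *)
Lemma bound_pairs_uniform (R : set (rule F M)) (S : set (dpair F M))
    (c : cmp) (delta : int) :
  finite_set R -> S `<=` DP R ->
  (forall x y, icmp c x y -> delta * y < delta * x) ->
  exists k, forall p v, bound_pairs P c S p -> fsem v (dcstr p) ->
    k <= delta * mval P v (dlhs p).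
Proof.
move=> finR SDP cP.
pose Q r k := forall p v, pair_of_rule r p -> bound_pairs P c S p ->
  fsem v (dcstr p) -> k <= delta * mval P v (dlhs p).
have [r k k' kk' Qk p v rp bp pv||k Qk] := @finite_uniform_bound _ R Q finR.
- by apply: le_trans kk' _; apply: Qk.
- move=> r Rr; have [[p0 [rp0 [_ [c0 bp0]]]]|np] :=
    pselect (exists p, pair_of_rule r p /\ bound_pairs P c S p); last first.
    by exists 0 => p v rp bp; case: np; exists p.
  exists (delta * teval (@fun_interp M) (of_void int) c0) => p v rp _.
  (* [c0] is ground, so the renaming from [p0] to [p] leaves the bound unchanged. *)
  have [rho [-> ->]] := pair_of_rule_renaming rp0 rp.
  rewrite mval_msubst fsem_fsubst => pv.
  have := valid_fsem (fun x => v (rho x)) bp0; move=> /(_ pv) [/fsem_fcmp|/fsem_feq];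
    rewrite teval_subst (@eq_teval _ _ _ _ (of_void int)) //.
    by move=> /cP /ltW.
  by rewrite -/(mval P _ _) => ->.
exists k => p v bp pv; have [r Rr rp] := DP_pair_of_rule (SDP _ bp.1).
exact: Qk Rr _ _ rp bp pv.
Qed.

(** A tail without pairs of [S'] would itself be an infinite chain of the smaller problem. *)
Lemma infinite_chain_frequently (S S' : set (dpair F M)) (R : set (rule F M))
    (p : nat -> dpair F M) (sigma : nat -> substitution F M)
    (s t : nat -> mterm F M) :
  (forall n, [/\ S (p n), root_step (p n) (sigma n) (s n) (t n),
     clos_refl_trans _ (mrewrite R) (t n) (s n.+1)
   & terminating_from (mrewrite R) (t n)]) ->
  dp_finite (S `\` S', R) -> forall n0, exists2 n, (n0 <= n)%N & S' (p n).
Proof.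
move=> ch fin n0; apply: contrapT => nS'; apply: fin.
exists (fun n => p (n0 + n)%N), (fun n => sigma (n0 + n)%N),
  (fun n => s (n0 + n)%N), (fun n => t (n0 + n)%N) => n.
have [Sp rs tr tm] := ch (n0 + n)%N; rewrite addnS; split=> //; split=> //.
by move=> S'p; apply: nS'; exists (n0 + n)%N => //; exact: leq_addr.
Qed.

End Pairs.

(** * The descent argument and the processor theorem *)

Lemma no_bounded_descent (f : nat -> int) (k : int) (n0 : nat) :
  (forall n, (n0 <= n)%N -> f n.+1 <= f n) ->
  (forall m, exists2 n, (m <= n)%N & (n0 <= n)%N -> f n.+1 < f n) ->
  (forall m, exists2 n, (m <= n)%N & (n0 <= n)%N -> k <= f n) -> False.
Proof.
move=> f_dec f_lt f_ge.
have f_mono m n : (n0 <= m)%N -> (m <= n)%N -> f n <= f m.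
  move=> n0m; elim: n => [|n IH]; first by rewrite leqn0 => /eqP->.
  rewrite leq_eqVlt => /orP[/eqP-> //|mn].
  apply: le_trans (IH mn); exact: f_dec (leq_trans n0m mn).
have f_desc (j : nat) : exists2 n, (n0 <= n)%N & f n <= f n0 - j%:Z.
  elim: j => [|j [n n0n fn]]; first by exists n0; rewrite ?subr0.
  have [m nm fm] := f_lt n; have n0m := leq_trans n0n nm.
  exists m.+1; first exact: leqW.
  by have := fm n0m; have := f_mono _ _ n0n nm; lia.
(* So many unit descents from [f n0] end below [k], and the sequence never climbs back. *)
have [n n0n fn] := f_desc `|f n0 - k|.+1.
have [m nm /(_ (leq_trans n0n nm)) km] := f_ge n.
by have := f_mono _ _ n0n nm; lia.
Qed.

(** Multiplying by the sign turns each comparison into [>] or [>=], so that the four processors are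
    treated at once. *)
Definition cmp_sign (c : cmp) : int :=
  match c with CGt | CGe => 1 | CLt | CLe => -1 end.

Theorem theorem3 (F : signature) (M : LIA)
  (R : set (rule F M)) (S : set (dpair F M)) (P : pol_interp F M)
  (c1 c2 c3 : cmp)
  (hc : List.In (c1, c2, c3)
          [:: (CGt, CGe, CGe); (CLt, CGe, CLe); (CGt, CLe, CLe); (CLt, CLe, CGe)])
  (hR : is_ctrs R) (hloc : locally_sound R) (hS : S `<=` DP R)
  (hA3 : condA3 (S, R)) (hA3o : condA3_other (S, R))
  (hi : forall (f : F) (i : 'I_(arity f)), lcoef (polf P f) i >= 0)
  (hii : forall r, R r ->
     valid (FImp (cstr r) (fcmp c2 (pol P (lhs r)) (pol P (rhs r)))))
  (hiii : forall (f : fsig F M) (i : 'I_(arity f)),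
     defined R f -> reducible_position S i -> icmp c3 (lcoef (polm P f) i) 0)
  (hiv : forall p, S p ->
     valid (FImp (dcstr p)
       (FOr (fcmp c1 (mpol P (dlhs p)) (mpol P (drhs p)))
            (feq (mpol P (dlhs p)) (mpol P (drhs p)))))) :
  sound_at (proc_PI P c1) (S, R) /\ complete_at (proc_PI P c1) (S, R).
Proof.
split; last first.
  (* Completeness: a chain of a subset of [S] is a chain of [S], and [R] is unchanged. *)
  have sub S' : dp_infinite (S `\` S', R) -> dp_infinite (S, R).
    case=> [/contrapT ch|]; [left|by right]; rewrite /dp_finite notE.
    have [p [sigma [s [t ch']]]] := ch; exists p, sigma, s, t => n.
    by have [[Sp _] ? ? ?] := ch' n.
  by case=> d' [] ->; exact: sub.
move=> fin; have fin_strict := fin _ (or_introl erefl).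
have {fin} fin_bound := fin _ (or_intror erefl).
move=> [p [sigma [s [t /= ch]]]].
have freq_strict := infinite_chain_frequently ch fin_strict.
have freq_bound := infinite_chain_frequently ch fin_bound.
(* In all four triples the third comparison with 0 says that [eta] times the coefficient is
   nonnegative. *)
pose delta := cmp_sign c1; pose eps := cmp_sign c2; pose eta := delta * eps.
have [c1P c2P c3P] : [/\ forall x y, icmp c1 x y -> delta * y < delta * x,
    forall x y, icmp c2 x y -> eps * y <= eps * x &
    forall x, icmp c3 x 0 -> 0 <= eta * x].
  rewrite /eta /delta /eps.
  by case: hc => [|[|[|[|//]]]] [<- <- <-]; split=> [x y|x y|x] /=; lia.
have [delta0 eps0 epsK] : [/\ delta != 0, eps != 0 & eta * eps = delta].
  by rewrite /eta /delta /eps; case: (c1); case: (c2).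
have eta0 : eta != 0 by rewrite mulf_neq0.
have rule_neg r : R r -> neg_args_interpreted P (fvars (cstr r)) (rhs r).
  by move=> Rr; apply: (condA3_neg_args hi hA3 hA3o) => u; left; exists r.
have rule_le r v : R r -> fsem v (cstr r) ->
    eps * pval P v (rhs r) <= eps * pval P v (lhs r).
  by move=> Rr rv; apply: c2P; have /(_ rv)/fsem_fcmp := valid_fsem v (hii _ Rr).
have pair_neg q i : S q ->
    neg_args_interpreted P (fvars (dcstr q)) (margs (drhs q) i).
  move=> Sq; apply: (condA3_neg_args hi hA3 hA3o) => u ui.
  by right; exists q => //; split=> //; exists i.
have pair_red q i : S q -> eta * lcoef (polm P (mroot (drhs q))) i < 0 ->
    interpreted (fvars (dcstr q)) (margs (drhs q) i).
  move=> Sq ci; apply: contrapT => ni.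
  (* The right-hand root of a dependency pair is defined, so (iii) forbids a reducible position with
     a coefficient of the wrong sign. *)
  have [r [de [C [_ _ [_ _ _ def]]]]] := hS _ Sq.
  have := c3P _ (hiii _ i def _); rewrite leNgt ci => /(_ _)/notF; apply.
  by exists q, (margs (drhs q)); split=> //; case: (drhs q).
have pair_le q v : S q -> fsem v (dcstr q) ->
    delta * mval P v (drhs q) <= delta * mval P v (dlhs q).
  move=> Sq qv; have /(_ qv) [/fsem_fcmp/c1P/ltW //|/fsem_feq] := valid_fsem v (hiv _ Sq).
  by rewrite /mval => ->.
have [k kP] := bound_pairs_uniform P hR.1 hS c1P.
have [n0 _ bound0] := freq_bound 0%N.
(* Instances may still contain variables; these get the value 0, as in [term_value]. *)
pose z (_ : nat) : int := 0.
have val_s n : mval P z (s n) = mval P (fun x => term_value P (sigma n x)) (dlhs (p n)).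
  by have [_ [_ -> _] _ _] := ch n; rewrite mval_msubst.
have val_t n : mval P z (t n) = mval P (fun x => term_value P (sigma n x)) (drhs (p n)).
  by have [_ [_ _ ->] _ _] := ch n; rewrite mval_msubst.
(* By (iv) a bound on the left-hand side for all [N] passes to the right-hand side, whose instance
   must then be good. *)
have good_t n b : (forall N, delta * mval P (shift P (sigma n) N) (dlhs (p n)) <= b) ->
    mgood P eta (t n).
  move=> bd; have [Sp [resp _ ->] _ _] := ch n.
  have [sG _] := respectsP P resp.
  apply: (bounded_msubst_good eta0 delta0 sG (fun i => pair_neg _ i Sp)
    (fun i => pair_red _ i Sp) (k := b)) => N.
  by apply: le_trans (bd N); apply: pair_le => //; apply: respects_shift.
have step n : mgood P eta (t n) -> mgood P eta (s n.+1) /\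
    delta * mval P z (s n.+1) <= delta * mval P z (t n).
  have [_ _ ts _] := ch n => gt; rewrite -epsK.
  exact: (mrewrites_good hR hloc eps0 rule_neg rule_le ts gt).
have good0 : mgood P eta (t n0).
  have [m mE] := mval_shift_linear P (sigma n0) (dlhs (p n0)).
  have [_ [resp _ _] _ _] := ch n0.
  have m0 : m = 0.
    (* [k] bounds from below, hence the signs in [- delta] and [- k]. *)
    apply: (@bounded_linear (- delta) (mval P (shift P (sigma n0) 0) (dlhs (p n0)))
      m (- k)) => [|N]; first by rewrite oppr_eq0.
    by rewrite -mE mulNr lerN2; exact: kP _ _ bound0 (respects_shift _ N resp).
  by apply: good_t => N; rewrite mE m0 mul0r addr0.
have good_tail n : (n0 <= n)%N -> mgood P eta (t n).
  elim: n => [|n IH]; first by rewrite leqn0 => /eqP <-.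
  rewrite leq_eqVlt => /orP[/eqP <- //|].
  move=> /IH /step [gs _]; have [_ [_ sE _] _ _] := ch n.+1.
  (* The left-hand instance is good, hence its shifted value is constant in [N]; the value at 0
     serves as the bound. *)
  apply: good_t => N; rewrite sE in gs.
  by rewrite (mval_shift_const N 0 gs).
apply: (@no_bounded_descent (fun n => delta * mval P z (s n)) k n0) => [n n0n|m|m].
- have [_ le_st] := step n (good_tail n n0n); apply: le_trans le_st _.
  have [Sp [resp _ _] _ _] := ch n.
  by rewrite val_s val_t; apply: pair_le Sp (respects_value _ resp).
- have [n mn [Sp strp]] := freq_strict m; exists n => // n0n.
  have [_ le_st] := step n (good_tail n n0n); apply: le_lt_trans le_st _.
  have [_ [resp _ _] _ _] := ch n; rewrite val_s val_t; apply: c1P.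
  apply/fsem_fcmp.
  exact: (valid_fsem (fun x => term_value P (sigma n x)) strp (respects_value P resp)).
- have [n mn bp] := freq_bound m; exists n => // n0n; rewrite val_s.
  have [_ [resp _ _] _ _] := ch n.
  exact: kP _ _ bp (respects_value _ resp).
Qed.
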